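(* There is an algorithm that solves CFFA in time $O\big((2t)^{t+1}(n+m)^{O(1)}\big)$, where $n=|\mathcal{A}|$, $m=|\mathcal{I}|$, and $t=\binom{m}{2}-|E(\mathcal{H})|$.
   Context: CFFA: the input is a finite set of agents $\mathcal{A}$, a finite set of jobs $\mathcal{I}$, for each agent $a\in\mathcal{A}$ a utility function $u_a\colon\mathcal{I}\to\mathbb{N}$, a positive integer $\eta$, and a graph $\mathcal{H}$ with vertex set $\mathcal{I}$. The question is whether there is $\phi\colon\mathcal{A}\to 2^{\mathcal{I}}$ such that each $\phi(a)$ is an independent set in $\mathcal{H}$ with $\sum_{x\in\phi(a)}u_a(x)\ge\eta$, and the sets $\phi(a)$, $a\in\mathcal{A}$, are pairwise disjoint.
   Formalization: For t = 0 (complete conflict graph) or n + m = 0 the stated bound can be 0, which no algorithm meets; the formal bound reads a vanishing factor (2t)^(t+1) or n+m as 1, and is the stated one for t ≥ 1. *)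

(* Defs.v *)
From mathcomp Require Import all_boot.

Set Implicit Arguments.
Unset Strict Implicit.
Unset Printing Implicit Defensive.

(* Conflict-free fair allocation. Agents and jobs are numbered, as in any     *)
(* machine-readable input.                                                    *)

Record cffa := Cffa {
  agents : nat;
  jobs : nat;
  utility : 'I_agents -> 'I_jobs -> nat;
  target : nat;
  conflict : rel 'I_jobs;
  target_gt0 : 0 < target;
  conflict_sym : symmetric conflict;
  conflict_irr : irreflexive conflict
}.

Definition independent (V : finType) (e : rel V) (S : {set V}) : Prop :=
  {in S &, forall x y, ~~ e x y}.

Definition edges (V : finType) (e : rel V) : {set {set V}} :=
  [set [set x; y] | x in V, y in V & e x y].

Definition is_solution (P : cffa) (phi : 'I_(agents P) -> {set 'I_(jobs P)})
    : Prop :=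
  [/\ forall a, independent (@conflict P) (phi a),
      forall a, target P <= \sum_(x in phi a) utility a x
    & forall a b, a != b -> [disjoint phi a & phi b]].

Definition solvable (P : cffa) : Prop := exists phi, @is_solution P phi.

Definition nonedges (P : cffa) : nat :=
  'C(jobs P, 2) - #|edges (@conflict P)|.

(* Model of computation: while programs on a random access machine with       *)
(* natural-number variables and one-dimensional arrays of natural numbers.    *)
(* A program mentions finitely many variables and arrays, each named by a     *)
(* constant. Every operation has unit cost; the only arithmetic operations    *)
(* are addition and truncated subtraction. Multiplication is left out on      *)
(* purpose: at unit cost, on unbounded numbers, it would make the machine     *)
(* unreasonably powerful.                                                     *)

Inductive expr :=
  | Const of nat
  | Var of nat
  | Read of nat & expr
  | Add of expr & expr
  | Sub of expr & expr.

Inductive cmd :=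
  | Skip
  | Assign of nat & expr
  | Write of nat & expr & expr
  | Seq of cmd & cmd
  | If of expr & cmd & cmd
  | While of expr & cmd.

Record state := State { vars : nat -> nat; arrays : nat -> nat -> nat }.

Fixpoint eval (s : state) (e : expr) : nat :=
  match e with
  | Const k => k
  | Var x => vars s x
  | Read r e1 => arrays s r (eval s e1)
  | Add e1 e2 => eval s e1 + eval s e2
  | Sub e1 e2 => eval s e1 - eval s e2
  end.

Fixpoint ecost (e : expr) : nat :=
  match e with
  | Const _ | Var _ => 1
  | Read _ e1 => (ecost e1).+1
  | Add e1 e2 | Sub e1 e2 => (ecost e1 + ecost e2).+1
  end.

Definition set_var (s : state) (x v : nat) : state :=
  State (fun y => if y == x then v else vars s y) (arrays s).

Definition set_array (s : state) (r i v : nat) : state :=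
  State (vars s)
    (fun q j => if (q == r) && (j == i) then v else arrays s q j).

(* [exec c s k s']: started in state [s], program [c] halts in state [s']     *)
(* after [k] elementary steps. A test succeeds when its value is nonzero.     *)
Inductive exec : cmd -> state -> nat -> state -> Prop :=
  | ExecSkip s : exec Skip s 1 s
  | ExecAssign s x e :
      exec (Assign x e) s (ecost e).+1 (set_var s x (eval s e))
  | ExecWrite s r e1 e2 :
      exec (Write r e1 e2) s (ecost e1 + ecost e2).+1
           (set_array s r (eval s e1) (eval s e2))
  | ExecSeq c1 c2 s1 s2 s3 k1 k2 :
      exec c1 s1 k1 s2 -> exec c2 s2 k2 s3 ->
      exec (Seq c1 c2) s1 (k1 + k2) s3
  | ExecIfTrue e c1 c2 s k s' :
      eval s e != 0 -> exec c1 s k s' ->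
      exec (If e c1 c2) s (ecost e + k).+1 s'
  | ExecIfFalse e c1 c2 s k s' :
      eval s e = 0 -> exec c2 s k s' ->
      exec (If e c1 c2) s (ecost e + k).+1 s'
  | ExecWhileTrue e c s1 s2 s3 k1 k2 :
      eval s1 e != 0 -> exec c s1 k1 s2 -> exec (While e c) s2 k2 s3 ->
      exec (While e c) s1 (ecost e + k1 + k2).+1 s3
  | ExecWhileFalse e c s :
      eval s e = 0 -> exec (While e c) s (ecost e).+1 s.

(* Input format: variables 0, 1, 2 hold the number of agents, the number of   *)
(* jobs and the target; arrays 0 and 1 hold the utility table and the         *)
(* adjacency matrix of the conflict graph in row-major order; everything else *)
(* is 0.                                                                      *)
Definition input (P : cffa) : state :=
  State (nth 0 [:: agents P; jobs P; target P])
    (fun r => nth 0 (nth [::]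
      [:: [seq utility a x | a <- enum 'I_(agents P), x <- enum 'I_(jobs P)];
          [seq nat_of_bool (conflict x y)
             | x <- enum 'I_(jobs P), y <- enum 'I_(jobs P)]] r)).

(* The answer is read off variable 0: nonzero means yes.                      *)
Definition solves_cffa_in (p : cmd) (T : cffa -> nat) : Prop :=
  forall P : cffa, exists k s,
    [/\ exec p (input P) k s, k <= T P & vars s 0 != 0 <-> solvable P].

(* [C * (2t)^(t+1) * (n+m)^c]. Either factor vanishes on degenerate instances *)
(* (t = 0, i.e. a complete conflict graph, or n + m = 0), where no positive   *)
(* running time could meet the bound; a vanishing factor is read as 1.        *)
Definition time_bound (C c : nat) (P : cffa) : nat :=
  let t := nonedges P in
  C * (maxn 1 ((2 * t) ^ (t + 1)) * (maxn 1 (agents P + jobs P)) ^ c).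

(* Main.v *)
Require Import Defs.
From mathcomp Require Import all_boot zify.

(* Order the jobs. A solution assigns to every job [v] a representative [r v <= v]   *)
(* that does not conflict with [v]: the least job of the bundle containing [v], or   *)
(* [v] itself if [v] is not handed out. The bundles are then fibres of [r].          *)
(* Spending one bit on each of the [t] pairs [w < v] of jobs without conflict, the   *)
(* bit saying whether [r v = w], lists all candidates for [r] with [2 ^ t] codes.    *)
(* For each of them it remains to match every agent to a fibre that is independent   *)
(* and that the agent values enough. This is done by an auction: as long as some     *)
(* agent is free, he takes the cheapest acceptable fibre, whose price rises by one.  *)
(* If a perfect matching exists then prices never exceed [n], so that the auction    *)
(* ends within [m * n] rounds. Finally [2 ^ t <= (2 * t) ^ (t + 1)] for [t > 0].     *)

Set Implicit Arguments.
Unset Strict Implicit.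
Unset Printing Implicit Defensive.

(** * Programs with counted loops *)

(* The bound [b] of [PFor x b p] is the name of a variable; [p] must not assign [x]  *)
(* or [b].                                                                            *)
Inductive prog :=
  | PSkip
  | PAssign of nat & expr
  | PWrite of nat & expr & expr
  | PSeq of prog & prog
  | PIf of expr & prog & prog
  | PFor of nat & nat & prog.

Fixpoint compile (p : prog) : cmd :=
  match p with
  | PSkip => Skip
  | PAssign x e => Assign x e
  | PWrite r e1 e2 => Write r e1 e2
  | PSeq p1 p2 => Seq (compile p1) (compile p2)
  | PIf e p1 p2 => If e (compile p1) (compile p2)
  | PFor x b p1 =>
      Seq (Assign x (Const 0))
        (While (Defs.Sub (Var b) (Var x))
           (Seq (compile p1) (Assign x (Add (Var x) (Const 1)))))
  end.

Fixpoint run (p : prog) (s : state) : state :=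
  match p with
  | PSkip => s
  | PAssign x e => set_var s x (eval s e)
  | PWrite r e1 e2 => set_array s r (eval s e1) (eval s e2)
  | PSeq p1 p2 => run p2 (run p1 s)
  | PIf e p1 p2 => if eval s e != 0 then run p1 s else run p2 s
  | PFor x b p1 =>
      iteri (vars s b) (fun i s1 => set_var (run p1 s1) x i.+1) (set_var s x 0)
  end.

Fixpoint mvars (p : prog) : seq nat :=
  match p with
  | PAssign x _ => [:: x]
  | PSeq p1 p2 | PIf _ p1 p2 => mvars p1 ++ mvars p2
  | PFor x _ p1 => x :: mvars p1
  | _ => [::]
  end.

Fixpoint marrays (p : prog) : seq nat :=
  match p with
  | PWrite r _ _ => [:: r]
  | PSeq p1 p2 | PIf _ p1 p2 => marrays p1 ++ marrays p2
  | PFor _ _ p1 => marrays p1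
  | _ => [::]
  end.

Fixpoint bounds (p : prog) : seq nat :=
  match p with
  | PSeq p1 p2 | PIf _ p1 p2 => bounds p1 ++ bounds p2
  | PFor _ b p1 => b :: bounds p1
  | _ => [::]
  end.

Fixpoint fresh_counters (p : prog) : bool :=
  match p with
  | PSeq p1 p2 | PIf _ p1 p2 => fresh_counters p1 && fresh_counters p2
  | PFor x _ p1 => (x \notin mvars p1) && fresh_counters p1
  | _ => true
  end.

Fixpoint cost (beta : nat -> nat) (p : prog) : nat :=
  match p with
  | PSkip => 1
  | PAssign _ e => (ecost e).+1
  | PWrite _ e1 e2 => (ecost e1 + ecost e2).+1
  | PSeq p1 p2 => cost beta p1 + cost beta p2
  | PIf e p1 p2 => (ecost e + (cost beta p1 + cost beta p2)).+1
  | PFor _ b p1 => beta b * (cost beta p1 + 8) + 6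
  end.

Fixpoint psize (p : prog) : nat :=
  match p with
  | PSkip => 1
  | PAssign _ e => (ecost e).+1
  | PWrite _ e1 e2 => (ecost e1 + ecost e2).+1
  | PSeq p1 p2 => psize p1 + psize p2
  | PIf e p1 p2 => (ecost e + (psize p1 + psize p2)).+1
  | PFor _ _ p1 => psize p1 + 14
  end.

Fixpoint depth (p : prog) : nat :=
  match p with
  | PSeq p1 p2 | PIf _ p1 p2 => depth p1 + depth p2
  | PFor _ _ p1 => (depth p1).+1
  | _ => 0
  end.

Definition same_outside (V A : seq nat) (s s' : state) : Prop :=
  (forall y, y \notin V -> vars s' y = vars s y) /\
  (forall r, r \notin A -> arrays s' r =1 arrays s r).

Lemma same_outside_refl V A s : same_outside V A s s.
Proof. by split. Qed.

Lemma same_outside_trans V A s1 s2 s3 :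
  same_outside V A s1 s2 -> same_outside V A s2 s3 -> same_outside V A s1 s3.
Proof.
move=> [v12 a12] [v23 a23]; split=> [y hy|r hr j].
  by rewrite v23 ?v12.
by rewrite a23 ?a12.
Qed.

Lemma same_outside_sub V A V' A' s s' : {subset V <= V'} -> {subset A <= A'} ->
  same_outside V A s s' -> same_outside V' A' s s'.
Proof.
move=> sV sA [hv ha]; split=> [y hy|r hr]; [apply: hv|apply: ha].
  by apply: contra hy => /sV.
by apply: contra hr => /sA.
Qed.

Lemma same_outside_set_var V A s x v : x \in V -> same_outside V A s (set_var s x v).
Proof. by move=> xV; split=> //= y; case: eqP => // ->; rewrite xV. Qed.

Lemma same_outside_iteri V A x (f : state -> state) n s :
  x \in V -> (forall s1, same_outside V A s1 (f s1)) ->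
  same_outside V A s (iteri n (fun i s1 => set_var (f s1) x i.+1) (set_var s x 0)).
Proof.
move=> xV hf; elim: n => [|n IHn] /=; first exact: same_outside_set_var.
apply: (same_outside_trans IHn).
exact: same_outside_trans (hf _) (same_outside_set_var _ _ _ xV).
Qed.

Lemma run_same p s : same_outside (mvars p) (marrays p) s (run p s).
Proof.
elim: p s => [|x e|r e1 e2|p1 IH1 p2 IH2|e p1 IH1 p2 IH2|x b p IHp] s /=.
- exact: same_outside_refl.
- by apply: same_outside_set_var; rewrite mem_head.
- by split=> //= q; rewrite inE => /negPf -> j.
- apply: same_outside_trans (same_outside_sub _ _ (IH1 s)) _;
    try (by move=> y hy; rewrite mem_cat hy).
  by apply: same_outside_sub (IH2 _) => y hy; rewrite mem_cat hy orbT.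
- case: ifP => _.
    by apply: same_outside_sub (IH1 _) => y hy; rewrite mem_cat hy.
  by apply: same_outside_sub (IH2 _) => y hy; rewrite mem_cat hy orbT.
- apply: same_outside_iteri => [|s1]; first exact: mem_head.
  by apply: same_outside_sub (IHp s1) => // y hy; rewrite inE hy orbT.
Qed.

Lemma run_var p s y : y \notin mvars p -> vars (run p s) y = vars s y.
Proof. by case: (run_same p s) => h _; apply: h. Qed.

Lemma run_array p s r j : r \notin marrays p -> arrays (run p s) r j = arrays s r j.
Proof. by case: (run_same p s) => _ h /h. Qed.

Lemma run_for_ind (I : nat -> state -> Prop) x b p s :
  x \notin mvars p -> I 0 (set_var s x 0) ->
  (forall i s1, i < vars s b -> vars s1 x = i ->
     same_outside (x :: mvars p) (marrays p) s s1 -> I i s1 ->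
     I i.+1 (set_var (run p s1) x i.+1)) ->
  I (vars s b) (run (PFor x b p) s).
Proof.
move=> xp I0 IS /=; move: (leqnn (vars s b)).
move: {-2}(vars s b) => n; elim: n => [//|n IHn] ltn /=.
apply: IS => //; last exact/IHn/ltnW.
  by case: n {IHn ltn} => [|n] /=; rewrite eqxx.
apply: same_outside_iteri => [|s1]; first exact: mem_head.
by apply: same_outside_sub (run_same p s1) => // y hy; rewrite inE hy orbT.
Qed.

Lemma exec_compile beta p s :
  fresh_counters p ->
  {in bounds p, forall b, vars s b <= beta b /\ b \notin mvars p} ->
  exists2 k, exec (compile p) s k (run p s) & k <= cost beta p.
Proof.
elim: p s => [|x e|r e1 e2|p1 IH1 p2 IH2|e p1 IH1 p2 IH2|x b p IHp] s /=.
- by exists 1 => //; constructor.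
- by exists (ecost e).+1 => //; constructor.
- by exists (ecost e1 + ecost e2).+1 => //; constructor.
- case/andP=> f1 f2 hb.
  have [y yb|k1 ex1 le1] := IH1 s f1.
    have [] := hb y; first by rewrite mem_cat yb.
    by rewrite mem_cat => ? /norP[].
  have [y yb|k2 ex2 le2] := IH2 (run p1 s) f2.
    have [] := hb y; first by rewrite mem_cat yb orbT.
    by rewrite mem_cat => ? /norP[? ?]; rewrite run_var.
  by exists (k1 + k2); [apply: ExecSeq ex1 ex2 | exact: leq_add].
- case/andP=> f1 f2 hb.
  case: (eqVneq (eval s e) 0) => he /=.
    have [y yb|k2 ex2 le2] := IH2 s f2.
      have [] := hb y; first by rewrite mem_cat yb orbT.
      by rewrite mem_cat => ? /norP[].
    by exists (ecost e + k2).+1; [apply: ExecIfFalse | lia].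
  have [y yb|k1 ex1 le1] := IH1 s f1.
    have [] := hb y; first by rewrite mem_cat yb.
    by rewrite mem_cat => ? /norP[].
  by exists (ecost e + k1).+1; [apply: ExecIfTrue | lia].
- case/andP=> xp fp hb.
  pose f i s1 := set_var (run p s1) x i.+1.
  pose st i := iteri i f (set_var s x 0).
  have stx i : vars (st i) x = i by case: i => [|i] /=; rewrite eqxx.
  have st_same i : same_outside (x :: mvars p) (marrays p) s (st i).
    apply: same_outside_iteri => [|s1]; first exact: mem_head.
    by apply: same_outside_sub (run_same p s1) => // y hy; rewrite inE hy orbT.
  have stv i y : y \notin x :: mvars p -> vars (st i) y = vars s y.
    by case: (st_same i) => h _ /h.
  have [|leb bx] := hb b; first exact: mem_head.
  pose w := While (Defs.Sub (Var b) (Var x))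
    (Seq (compile p) (Assign x (Add (Var x) (Const 1)))).
  have loop d i : i + d = vars s b ->
      exists2 k, exec w (st i) k (st (vars s b)) & k <= d * (cost beta p + 8) + 4.
    elim: d i => [|d IHd] i hi.
      exists 4 => //; rewrite -hi addn0.
      by apply: ExecWhileFalse; rewrite /= stx stv // -hi addn0 subnn.
    have [|k2 ex2 le2] := IHd i.+1; first by rewrite addSnnS.
    have [y yb|k1 ex1 le1] := IHp (st i) fp.
      have [|? hy] := hb y; first by rewrite inE yb orbT.
      by rewrite stv //; split=> //; move: hy; rewrite inE => /norP[].
    exists (3 + (k1 + 4) + k2).+1; last by lia.
    apply: ExecWhileTrue ex2; first by rewrite /= stx stv //; lia.
    apply: ExecSeq ex1 _.
    have -> : st i.+1 = set_var (run p (st i)) x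
        (eval (run p (st i)) (Add (Var x) (Const 1))).
      by rewrite /= run_var // stx addn1.
    exact: ExecAssign.
  have [|k ex le] := loop (vars s b) 0; first by [].
  exists (2 + k); first by apply: ExecSeq ex; apply: ExecAssign.
  apply: leq_trans (_ : 2 + (vars s b * (cost beta p + 8) + 4) <= _).
    by rewrite leq_add2l.
  by have := leq_mul2r (cost beta p + 8) (vars s b) (beta b); rewrite leb orbT; lia.
Qed.

Lemma cost_poly (beta : nat -> nat) S p : 0 < S -> {in bounds p, forall b, beta b <= S} ->
  cost beta p <= psize p * S ^ depth p.
Proof.
move=> S0.
have Sd d d' : S ^ d <= S ^ (d + d') by rewrite leq_pexp2l // leq_addr.
have S1 d : 0 < S ^ d by rewrite expn_gt0 S0.
elim: p => [|x e|r e1 e2|p1 IH1 p2 IH2|e p1 IH1 p2 IH2|x b p IHp] hb /=;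
  rewrite ?muln1 //.
- have {}IH1 := IH1 (fun y hy => hb y ltac:(by rewrite /= mem_cat hy)).
  have {}IH2 := IH2 (fun y hy => hb y ltac:(by rewrite /= mem_cat hy orbT)).
  rewrite mulnDl; apply: leq_add.
    by apply: leq_trans IH1 _; rewrite leq_mul2l Sd orbT.
  by apply: leq_trans IH2 _; rewrite leq_mul2l addnC Sd orbT.
- have {}IH1 := IH1 (fun y hy => hb y ltac:(by rewrite /= mem_cat hy)).
  have {}IH2 := IH2 (fun y hy => hb y ltac:(by rewrite /= mem_cat hy orbT)).
  have le1 : psize p1 * S ^ depth p1 <= psize p1 * S ^ (depth p1 + depth p2).
    by rewrite leq_mul2l Sd orbT.
  have le2 : psize p2 * S ^ depth p2 <= psize p2 * S ^ (depth p1 + depth p2).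
    by rewrite leq_mul2l addnC Sd orbT.
  have le3 : (ecost e).+1 <= (ecost e).+1 * S ^ (depth p1 + depth p2).
    by rewrite leq_pmulr.
  set X := S ^ (depth p1 + depth p2) in le1 le2 le3 *.
  suff -> : (ecost e + (psize p1 + psize p2)).+1 * X
    = (ecost e).+1 * X + (psize p1 * X + psize p2 * X) by lia.
  by rewrite -!mulnDl addSn.
- have {}IHp := IHp (fun y hy => hb y ltac:(by rewrite /= inE hy orbT)).
  have leb := hb b (mem_head _ _).
  rewrite expnS; have := S1 (depth p); set X := S ^ _ in IHp * => X0.
  have h1 : beta b * (cost beta p + 8) <= S * (psize p * X + 8).
    by rewrite leq_mul ?leq_add2r.
  by nia.
Qed.

(** * The auction for bipartite matching *)

Section Auction.

Variables (n m : nat) (fit : nat -> nat -> bool).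

(* Owners are stored shifted by one: [own j = a.+1] when agent [a] holds job [j], *)
(* and [own j = 0] when nobody does. *)
Definition holds (own : nat -> nat) a := exists2 j, j < m & own j = a.+1.

Definition lacks (own : nat -> nat) a := forall j, j < m -> own j != a.+1.

Inductive bid (own price own' price' : nat -> nat) : Prop :=
  | BidNone : own' =1 own -> price' =1 price ->
      (forall a, a < n -> holds own a) -> bid own price own' price'
  | BidStuck a : own' =1 own -> price' =1 price -> a < n -> lacks own a ->
      (forall j, j < m -> ~~ fit a j) -> bid own price own' price'
  | BidOn a j : a < n -> lacks own a -> j < m -> fit a j ->
      (forall k, k < m -> fit a k -> price j <= price k) ->
      own' =1 (fun k => if k == j then a.+1 else own k) ->
      price' =1 (fun k => if k == j then (price j).+1 else price k) ->
      bid own price own' price'.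

Definition fair (own : nat -> nat) := forall j, j < m -> own j != 0 ->
  own j <= n /\ fit (own j).-1 j.

Lemma bid_fair own price own' price' :
  bid own price own' price' -> fair own -> fair own'.
Proof.
case=> [eo _ _|a eo _ _ _ _|a j an _ _ faj _ eo _] F k km; rewrite eo //; try exact: F.
by case: (k =P j) => [-> _|_]; [split | apply: F].
Qed.

Section Matching.

Variable M : nat -> nat.
Hypothesis M_lt : forall a, a < n -> M a < m.
Hypothesis M_fit : forall a, a < n -> fit a (M a).
Hypothesis M_inj : forall a b, a < n -> b < n -> M a = M b -> a = b.

Record balanced (k : nat) (own price : nat -> nat) : Prop := Balanced {
  balanced_fair : fair own;
  balanced_inj : forall i j, i < m -> j < m -> own i = own j -> own i != 0 -> i = j;
  balanced_zero : forall j, j < m -> own j = 0 -> price j = 0;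
  balanced_near : forall j a i, j < m -> i < m -> own j = a.+1 -> fit a i ->
    price j <= (price i).+1;
  balanced_cap : forall j, j < m -> price j <= n;
  balanced_progress : (forall a, a < n -> holds own a) \/ \sum_(j < m) price j = k
}.

(* The owner of an agent's partner has a partner that is cheaper by at most one, and  *)
(* the free agent owns nothing; hence passing to owners injects the agents whose      *)
(* partner costs more than [k] properly into those whose partner costs at least [k].  *)
Lemma free_partner_price k own price a : balanced k own price -> a < n -> lacks own a ->
  price (M a) < n.
Proof.
move=> bal an free_a.
pose A h := [set b : 'I_n | h <= price (M b)].
pose g (b : 'I_n) := insubd (Ordinal an) (own (M b)).-1.
have ownP (b : 'I_n) : 0 < price (M b) ->
    exists2 c : 'I_n, own (M b) = c.+1 & g b = c.
  move=> p0; have mb := M_lt (ltn_ord b).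
  have ob : own (M b) != 0.
    by apply: contraTneq p0 => /(balanced_zero bal mb) ->.
  have [le _] := balanced_fair bal mb ob.
  have lt : (own (M b)).-1 < n by lia.
  exists (Ordinal lt); first by rewrite /=; lia.
  by apply: val_inj; rewrite val_insubd lt.
have decr h : h < price (M a) -> #|A h.+1| < #|A h|.
  move=> ha; rewrite (cardsD1 (Ordinal an) (A h)) inE /= (ltnW ha) add1n ltnS.
  rewrite -(@card_in_imset _ _ g); last first.
    move=> b c; rewrite !inE => hb hc gbc.
    have [b' ob gb] := ownP b (leq_ltn_trans (leq0n h) hb).
    have [c' oc gc] := ownP c (leq_ltn_trans (leq0n h) hc).
    apply: val_inj; apply: M_inj; rewrite ?ltn_ord //.
    apply: (balanced_inj bal); rewrite ?M_lt ?ltn_ord ?ob //.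
    by rewrite oc -gb -gc gbc.
  apply/subset_leq_card/subsetP => _ /imsetP[b hb ->]; move: hb; rewrite !inE => hb.
  have [c oc ->] := ownP b (leq_ltn_trans (leq0n h) hb).
  have near : price (M b) <= (price (M c)).+1.
    by apply: (balanced_near bal) oc _; rewrite ?M_lt ?M_fit.
  rewrite -ltnS (leq_trans hb near) andbT; apply/eqP => ca.
  by have := free_a _ (M_lt (ltn_ord b)); rewrite oc ca eqxx.
have : #|A (price (M a))| + price (M a) <= n.
  suff H h : h <= price (M a) -> #|A h| + h <= n by exact: H.
  elim: h => [_|h IHh hp]; first by rewrite addn0 -[leqRHS]card_ord max_card.
  by have := decr h hp; have := IHh (ltnW hp); lia.
have : 0 < #|A (price (M a))| by apply/card_gt0P; exists (Ordinal an); rewrite inE.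
by lia.
Qed.

Lemma bid_balanced k own price own' price' : bid own price own' price' ->
  balanced k own price -> balanced k.+1 own' price'.
Proof.
move=> B bal; have fair' := bid_fair B (balanced_fair bal).
case: bal (bal) => _ inj zero near cap progress bal.
case: B => [eo ep all_hold|a _ _ an _ nofit|a j an free_a jm faj best eo ep].
- split=> //; do ?[by move=> *; move: (@inj i j); rewrite -!eo => H; apply: H].
  + by move=> i j im jm; rewrite !eo; apply: inj.
  + by move=> j jm; rewrite eo ep; apply: zero.
  + by move=> j a i jm im; rewrite eo !ep; apply: near.
  + by move=> j jm; rewrite ep cap.
  + by left=> a /all_hold[j jm oj]; exists j; rewrite ?eo.
- by have := nofit _ (M_lt an); rewrite M_fit.
have price_j : price j < n.
  by apply: leq_ltn_trans (free_partner_price bal an free_a); rewrite best ?M_lt ?M_fit.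
split=> //.
- move=> i i' im i'm; rewrite !eo.
  case: eqVneq => [->|_]; case: eqVneq => [-> //|_] //; last exact: inj.
    by move=> e; have := free_a _ i'm; rewrite -e eqxx.
  by move=> e; have := free_a _ im; rewrite e eqxx.
- by move=> i im; rewrite eo ep; case: eqVneq => // _; apply: zero.
- move=> i b i' im i'm; rewrite eo !ep; case: eqVneq => [_ [<-] fai'|_ oi fbi'].
    by rewrite ltnS; case: eqVneq => // _; apply: best.
  by have := near _ _ _ im i'm oi fbi'; case: eqVneq => // ->; lia.
- by move=> i im; rewrite ep; case: eqVneq => // _; apply: cap.
- case: progress => [all_hold|<-].
    by have [j' j'm oj'] := all_hold _ an; have := free_a _ j'm; rewrite oj' eqxx.
  right; rewrite (bigD1 (Ordinal jm)) //= [in RHS](bigD1 (Ordinal jm)) //=.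
  rewrite ep eqxx addSn; congr (_ + _).+1.
  by apply: eq_bigr => i; rewrite ep -val_eqE /= => /negPf ->.
Qed.

Lemma balanced0 own price : (forall j, j < m -> own j = 0) ->
  (forall j, j < m -> price j = 0) -> balanced 0 own price.
Proof.
move=> o0 p0; split.
- by move=> j /o0 ->.
- by move=> i j im _ _; rewrite o0.
- by move=> j /p0.
- by move=> j a i jm _; rewrite o0.
- by move=> j /p0 ->.
- by right; apply: big1 => j _; apply: p0.
Qed.

Lemma balanced_end k own price : balanced k own price -> m * n < k ->
  forall a, a < n -> holds own a.
Proof.
move=> bal lt; case: (balanced_progress bal) => // sum_k; exfalso.
suff : \sum_(j < m) price j <= m * n by lia.
rewrite -[m in m * n]card_ord -sum_nat_const; apply: leq_sum => j _.
by apply: (balanced_cap bal).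
Qed.

End Matching.

End Auction.

Lemma run_seq p1 p2 s : run (PSeq p1 p2) s = run p2 (run p1 s).
Proof. by []. Qed.

Lemma run_assign x e s : run (PAssign x e) s = set_var s x (eval s e).
Proof. by []. Qed.

Lemma run_write r e1 e2 s :
  run (PWrite r e1 e2) s = set_array s r (eval s e1) (eval s e2).
Proof. by []. Qed.

Lemma run_if e p1 p2 s :
  run (PIf e p1 p2) s = if eval s e != 0 then run p1 s else run p2 s.
Proof. by []. Qed.

Lemma run_skip s : run PSkip s = s.
Proof. by []. Qed.

Definition runE := (run_skip, run_seq, run_assign, run_write, run_if).

Arguments run : simpl never.

(** * The program *)

Local Notation v_agents := 0 (only parsing).
Local Notation v_jobs := 1 (only parsing).
Local Notation v_target := 2 (only parsing).
Local Notation v_size := 3 (only parsing).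
Local Notation v_count := 4 (only parsing).
Local Notation v_answer := 5 (only parsing).
Local Notation v_code := 6 (only parsing).
Local Notation v_acc := 7 (only parsing).
Local Notation v_i := 8 (only parsing).
Local Notation v_j := 9 (only parsing).
Local Notation v_k := 10 (only parsing).
Local Notation v_a := 11 (only parsing).
Local Notation v_flag := 12 (only parsing).
Local Notation v_free := 13 (only parsing).
Local Notation v_best := 14 (only parsing).

Local Notation a_utility := 0 (only parsing).
Local Notation a_conflict := 1 (only parsing).
Local Notation a_rep := 2 (only parsing).
Local Notation a_price := 3 (only parsing).
Local Notation a_owner := 4 (only parsing).
Local Notation a_row := 5 (only parsing).
Local Notation a_fit := 6 (only parsing).

Definition cell (i j : nat) : expr := Add (Read a_row (Var i)) (Var j).
Definition neq (e1 e2 : expr) : expr := Add (Defs.Sub e1 e2) (Defs.Sub e2 e1).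
Definition pred_var (x : nat) : expr := Defs.Sub (Var x) (Const 1).
Definition succ_var (x : nat) : expr := Add (Var x) (Const 1).

Definition if_pair (p : prog) : prog :=
  PIf (Defs.Sub (Var v_i) (Var v_j))
    (PIf (Read a_conflict (cell v_i v_j)) PSkip p) PSkip.

Definition p_size : prog :=
  PAssign v_size (Add (Add (Var v_agents) (Var v_jobs)) (Const 1)).

(* A table of the multiples of the number of jobs makes up for the missing           *)
(* multiplication in the addressing of two-dimensional tables.                       *)
Definition p_rows : prog :=
  PSeq (PAssign v_acc (Const 0))
    (PFor v_i v_size
      (PSeq (PWrite a_row (Var v_i) (Var v_acc))
        (PAssign v_acc (Add (Var v_acc) (Var v_jobs))))).

Definition p_count : prog :=
  PSeq (PAssign v_count (Const 1))
    (PFor v_i v_jobs (PFor v_j v_jobs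
      (if_pair (PAssign v_count (Add (Var v_count) (Var v_count)))))).

(* The code is a binary number whose leading bit is read by doubling and comparing   *)
(* with [2 ^ t].                                                                      *)
Definition p_decode : prog :=
  PSeq (PAssign v_acc (Var v_code))
    (PFor v_i v_jobs
      (PSeq (PWrite a_rep (Var v_i) (Var v_i))
        (PFor v_j v_jobs
          (if_pair
            (PSeq (PAssign v_acc (Add (Var v_acc) (Var v_acc)))
              (PIf (Defs.Sub (Var v_count) (Var v_acc)) PSkip
                (PSeq (PAssign v_acc (Defs.Sub (Var v_acc) (Var v_count)))
                  (PWrite a_rep (Var v_i) (Var v_j))))))))).

Definition p_independent : prog :=
  PSeq (PAssign v_flag (Const 1))
    (PFor v_j v_jobs (PFor v_k v_jobs
      (PIf (Read a_conflict (cell v_j v_k))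
        (PIf (neq (Read a_rep (Var v_j)) (Var v_i)) PSkip
          (PIf (neq (Read a_rep (Var v_k)) (Var v_i)) PSkip
            (PAssign v_flag (Const 0))))
        PSkip))).

Definition p_sum : prog :=
  PSeq (PAssign v_acc (Const 0))
    (PFor v_j v_jobs
      (PIf (neq (Read a_rep (Var v_j)) (Var v_i)) PSkip
        (PAssign v_acc (Add (Var v_acc) (Read a_utility (cell v_a v_j)))))).

(* Subtraction being truncated, [flag - (target - acc)] is 1 if [flag = 1] and       *)
(* [target <= acc], and 0 otherwise.                                                  *)
Definition p_fit : prog :=
  PFor v_i v_jobs
    (PSeq p_independent
      (PFor v_a v_agents
        (PSeq p_sum
          (PWrite a_fit (cell v_a v_i)
            (Defs.Sub (Var v_flag) (Defs.Sub (Var v_target) (Var v_acc))))))).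

(* [v_free] and [v_best] hold an index plus one; 0 stands for none. *)
Definition p_free : prog :=
  PSeq (PAssign v_free (Const 0))
    (PFor v_a v_agents
      (PSeq (PAssign v_flag (Const 0))
        (PSeq
          (PFor v_k v_jobs
            (PIf (neq (Read a_owner (Var v_k)) (succ_var v_a)) PSkip
              (PAssign v_flag (Const 1))))
          (PIf (Var v_flag) PSkip (PAssign v_free (succ_var v_a)))))).

Definition p_best : prog :=
  PSeq (PAssign v_a (pred_var v_free))
    (PSeq (PAssign v_best (Const 0))
      (PFor v_k v_jobs
        (PIf (Read a_fit (cell v_a v_k))
          (PIf (Var v_best)
            (PIf (Defs.Sub (Read a_price (pred_var v_best)) (Read a_price (Var v_k)))
              (PAssign v_best (succ_var v_k)) PSkip)
            (PAssign v_best (succ_var v_k)))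
          PSkip))).

Definition p_bid : prog :=
  PSeq p_free
    (PIf (Var v_free)
      (PSeq p_best
        (PIf (Var v_best)
          (PSeq (PWrite a_owner (pred_var v_best) (Var v_free))
            (PWrite a_price (pred_var v_best)
              (Add (Read a_price (pred_var v_best)) (Const 1))))
          PSkip))
      PSkip).

Definition p_auction : prog :=
  PSeq
    (PFor v_i v_jobs
      (PSeq (PWrite a_owner (Var v_i) (Const 0)) (PWrite a_price (Var v_i) (Const 0))))
    (PFor v_i v_size (PFor v_j v_size p_bid)).

Definition p_try : prog :=
  PSeq p_decode (PSeq p_fit (PSeq p_auction (PSeq p_free
    (PIf (Var v_free) PSkip (PAssign v_answer (Const 1)))))).

Definition p_init : prog := PSeq p_rows p_count.
Definition p_search : prog := PFor v_code v_count p_try.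

Definition main : cmd :=
  Seq (compile p_size) (Seq (compile p_init)
    (Seq (compile p_search) (Assign 0 (Var v_answer)))).

(** * Correctness of the program *)

Section Spec.

Variables (n m tgt : nat) (U0 E0 : nat -> nat).

Let U a x := U0 (a * m + x).
Let E x y := E0 (x * m + y) != 0.

Definition pair v w := (w < v) && ~~ E v w.

Definition npairs := \sum_(v < m) count (pair v) (iota 0 m).

Record ready (s : state) : Prop := Ready {
  ready_agents : vars s v_agents = n;
  ready_jobs : vars s v_jobs = m;
  ready_target : vars s v_target = tgt;
  ready_size : vars s v_size = (n + m).+1;
  ready_utility : forall i, arrays s a_utility i = U0 i;
  ready_conflict : forall i, arrays s a_conflict i = E0 i;
  ready_row : forall i, i <= n + m -> arrays s a_row i = i * m
}.

Lemma ready_same V A s s' : same_outside V A s s' ->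
  all (fun y => y \notin V) [:: v_agents; v_jobs; v_target; v_size] ->
  all (fun r => r \notin A) [:: a_utility; a_conflict; a_row] ->
  ready s -> ready s'.
Proof.
move=> [hv ha] /and5P[? ? ? ? _] /and4P[? ? ? _] [*].
by split=> *; rewrite ?hv ?ha //; auto.
Qed.

Lemma ready_run p s :
  all (fun y => y \notin mvars p) [:: v_agents; v_jobs; v_target; v_size] ->
  all (fun r => r \notin marrays p) [:: a_utility; a_conflict; a_row] ->
  ready s -> ready (run p s).
Proof. exact: ready_same (run_same p s). Qed.

Lemma ready_set_var s x v : x \notin [:: v_agents; v_jobs; v_target; v_size] ->
  ready s -> ready (set_var s x v).
Proof.
move=> hx [*]; move: hx; rewrite !inE !negb_or => /and4P[? ? ? ?].
by split=> //=; rewrite ifN // eq_sym.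
Qed.

Lemma eval_cell s i j : ready s -> vars s i <= n + m ->
  eval s (cell i j) = vars s i * m + vars s j.
Proof. by move=> Rs le /=; rewrite (ready_row Rs). Qed.

Lemma eval_neq s e1 e2 : (eval s (neq e1 e2) != 0) = (eval s e1 != eval s e2).
Proof. by rewrite /=; lia. Qed.

Lemma run_if_pair p s : ready s -> vars s v_i < m -> vars s v_j < m ->
  run (if_pair p) s = if pair (vars s v_i) (vars s v_j) then run p s else s.
Proof.
move=> Rs hi hj; rewrite /if_pair !runE /pair /E.
have -> : eval s (Read a_conflict (cell v_i v_j)) = E0 (vars s v_i * m + vars s v_j).
  by rewrite -(ready_conflict Rs) -eval_cell //; lia.
rewrite /= -lt0n subn_gt0; case: ltnP => //= _.
by case: eqVneq.
Qed.

Fixpoint encode (l : seq bool) : nat :=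
  if l is b :: l' then b * 2 ^ size l' + encode l' else 0.

Lemma encode_lt l : encode l < 2 ^ size l.
Proof. by elim: l => //= b l IHl; rewrite expnS; case: b => /=; lia. Qed.

(* Reading the leading bit of a code that was shifted to the left within [T] bits. *)
Lemma encode_shift T b l : (size l).+1 <= T ->
  let c := encode (b :: l) * 2 ^ (T - (size l).+1) in
  c + c = b * 2 ^ T + encode l * 2 ^ (T - size l) /\
  encode l * 2 ^ (T - size l) < 2 ^ T.
Proof.
move=> lT; set k := T - (size l).+1; have -> : T - size l = k.+1 by lia.
have eT : 2 ^ T = 2 ^ size l * 2 ^ k.+1 by rewrite -expnD; congr (2 ^ _); lia.
split; first by rewrite /= eT expnS; case: b => /=; nia.
by rewrite eT ltn_pmul2r ?expn_gt0 ?encode_lt.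
Qed.

Section Decode.

Variable r : nat -> nat.

Definition bits_below v : seq bool :=
  flatten [seq [seq r u == w | w <- iota 0 m & pair u w] | u <- iota v (m - v)].

Definition bits_from v w : seq bool :=
  [seq r v == w' | w' <- iota w (m - w) & pair v w'] ++ bits_below v.+1.

Lemma bits_from_start v : v < m -> bits_from v 0 = bits_below v.
Proof.
by move=> vm; rewrite /bits_from /bits_below subn0 -(subnSK vm).
Qed.

Lemma bits_from_end v : bits_from v m = bits_below v.+1.
Proof. by rewrite /bits_from subnn. Qed.

Lemma bits_fromS v w : w < m ->
  bits_from v w = if pair v w then (r v == w) :: bits_from v w.+1 else bits_from v w.+1.
Proof. by move=> wm; rewrite /bits_from -(subnSK wm) /=; case: ifP. Qed.

Lemma size_bits : size (bits_below 0) = npairs.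
Proof.
rewrite /bits_below size_flatten /shape -map_comp subn0 sumnE big_map.
rewrite -{1}(subn0 m) -/(index_iota 0 m) big_mkord.
by apply: eq_bigr => v _; rewrite /= size_map size_filter.
Qed.

Hypothesis r_le : forall v, v < m -> r v <= v.
Hypothesis r_free : forall v, v < m -> ~~ E v (r v).

Lemma decode_correct s : ready s -> vars s v_count = 2 ^ npairs ->
  vars s v_code = encode (bits_below 0) ->
  forall v, v < m -> arrays (run p_decode s) a_rep v = r v.
Proof.
move=> Rs sN sC; rewrite /p_decode runE run_assign.
set s0 := set_var _ _ _.
have Rs0 : ready s0 by apply: ready_set_var.
pose I v s' := [/\ size (bits_below v) <= npairs,
  vars s' v_acc = encode (bits_below v) * 2 ^ (npairs - size (bits_below v)) &
  forall u, u < v -> arrays s' a_rep u = r u].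
set p := PSeq _ _.
suff [_ _] : I (vars s0 v_jobs) (run (PFor v_i v_jobs p) s0).
  by rewrite (ready_jobs Rs0).
apply: run_for_ind => //.
  by split; rewrite ?size_bits //= subnn muln1 /= sC.
rewrite (ready_jobs Rs0) => v s1 vm s1v same1 [szv accv repv].
have Rs1 : ready s1 by apply: ready_same same1 _ _ Rs0.
have N1 : vars s1 v_count = 2 ^ npairs by case: same1 => -> .
rewrite /p runE run_write /=; set s2 := set_array _ _ _ _.
have Rs2 : ready s2 by case: Rs1 => *; split.
pose J w s' := [/\ size (bits_from v w) <= npairs,
  vars s' v_acc = encode (bits_from v w) * 2 ^ (npairs - size (bits_from v w)),
  forall u, u < v -> arrays s' a_rep u = r u &
  arrays s' a_rep v = if r v < w then r v else v].
set q := if_pair _.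
suff : J (vars s2 v_jobs) (run (PFor v_j v_jobs q) s2).
  rewrite (ready_jobs Rs2) => -[]; rewrite bits_from_end => ? acc' rep'.
  rewrite (leq_ltn_trans (r_le vm) vm) => repv'.
  split=> // u; rewrite ltnS leq_eqVlt => /predU1P[->|] //; exact: rep'.
apply: run_for_ind => //.
  split; rewrite ?bits_from_start //= ?s1v ?eqxx // => u uv.
  by rewrite ltn_eqF // repv.
rewrite (ready_jobs Rs2) => w s3 wm s3w same3 [szw accw repw repvw].
have Rs3 : ready s3 by apply: ready_same same3 _ _ Rs2.
have N3 : vars s3 v_count = 2 ^ npairs by case: same3 => -> .
have s3v : vars s3 v_i = v by case: same3 => ->.
rewrite run_if_pair ?s3v ?s3w //.
move: szw accw; rewrite bits_fromS //.
case: ifP => [pvw|npvw] szw accw; last first.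
  split=> //=; rewrite repvw ltnS [r v <= w]leq_eqVlt.
  case: eqVneq => //= rvw; case: ifP => // _.
  move: npvw; rewrite /pair -rvw r_free // andbT ltn_neqAle r_le // andbT.
  by move/negbFE/eqP.
have [acc2 lt2] := encode_shift (r v == w) szw.
have {}acc2 := etrans (congr2 addn accw accw) acc2.
rewrite !runE /= N3 acc2; set T := 2 ^ npairs in acc2 lt2 *.
set c := encode _ * _ in acc2 lt2 *.
have szw' : size (bits_from v w.+1) <= npairs by move: szw => /=; lia.
case: (eqVneq (r v) w) => rvw /=.
  have -> : (T - (1 * T + c) != 0) = false by lia.
  split=> //=.
  - by rewrite -/T -/c; lia.
  - by move=> u uv; rewrite ifN ?repw // s3v neq_ltn uv.
  - by rewrite s3v eqxx s3w rvw leqnn.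
have -> : (T - (0 * T + c) != 0) = true by lia.
by split=> //=; rewrite repvw [_ < w.+1]ltnS [r v <= w]leq_eqVlt (negPf rvw).
Qed.

End Decode.

Lemma rows_correct s : vars s v_agents = n -> vars s v_jobs = m ->
  vars s v_target = tgt -> vars s v_size = (n + m).+1 ->
  arrays s a_utility =1 U0 -> arrays s a_conflict =1 E0 -> ready (run p_rows s).
Proof.
move=> sn sm st ss sU sE.
split=> [||||i|i|]; rewrite ?run_var ?run_array //.
rewrite /p_rows runE run_assign; set s0 := set_var _ _ _.
pose I i s' := vars s' v_acc = i * m /\
  forall k, k < i -> arrays s' a_row k = k * m.
set p := PSeq _ _.
suff [_] : I (vars s0 v_size) (run (PFor v_i v_size p) s0) by rewrite /= ss.
apply: run_for_ind => //= i s1 _ s1i [same _] [acc1 row1].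
rewrite /p !runE /= s1i acc1; split=> /= [|k].
  by rewrite same //= sm; lia.
by rewrite ltnS leq_eqVlt; case: eqVneq => [->|_ /row1].
Qed.

Lemma count_correct s : ready s -> vars (run p_count s) v_count = 2 ^ npairs.
Proof.
move=> Rs; rewrite /p_count runE run_assign; set s0 := set_var _ _ _.
have Rs0 : ready s0 by apply: ready_set_var.
pose I i s' := vars s' v_count = 2 ^ \sum_(v < i) count (pair v) (iota 0 m).
set p := PFor v_j _ _.
suff : I (vars s0 v_jobs) (run (PFor v_i v_jobs p) s0) by rewrite (ready_jobs Rs0).
apply: run_for_ind => //=; first by rewrite /I big_ord0.
rewrite (ready_jobs Rs) /I => v s1 vm s1v same1 c1.
have Rs1 : ready s1 by apply: ready_same same1 _ _ Rs0.
pose J w s' := vars s' v_count =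
  2 ^ (\sum_(u < v) count (pair u) (iota 0 m) + count (pair v) (iota 0 w)).
suff : J (vars s1 v_jobs) (run p s1) by rewrite (ready_jobs Rs1) /J big_ord_recr.
apply: run_for_ind => //=; first by rewrite /J addn0.
rewrite (ready_jobs Rs1) /J => w s2 wm s2w same2 c2.
have Rs2 : ready s2 by apply: ready_same same2 _ _ Rs1.
have s2v : vars s2 v_i = v by case: same2 => ->.
rewrite run_if_pair ?s2v ?s2w // -[in iota 0 w.+1]addn1 iotaD count_cat /= addn0.
by case: ifP => _; rewrite ?run_assign /= c2 ?addn0 // addn1 addnS expnS mul2n addnn.
Qed.

Section Fit.

Variable r : nat -> nat.

Definition fibre_free j := \big[andb/true]_(x < m) \big[andb/true]_(y < m)
  ~~ [&& E x y, r x == j & r y == j].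

Definition fits a j := fibre_free j && (tgt <= \sum_(x < m | r x == j) U a x).

Lemma independent_correct s : ready s -> vars s v_i < m ->
  (forall x, x < m -> arrays s a_rep x = r x) ->
  vars (run p_independent s) v_flag = fibre_free (vars s v_i).
Proof.
move=> Rs jm sr; set j := vars s v_i in jm *.
rewrite /p_independent runE run_assign; set s0 := set_var _ _ _.
have Rs0 : ready s0 by apply: ready_set_var.
pose B x := \big[andb/true]_(y < m) ~~ [&& E x y, r x == j & r y == j].
pose I i s' := vars s' v_flag = \big[andb/true]_(x < i) B x.
set p := PFor v_k _ _.
suff : I (vars s0 v_jobs) (run (PFor v_j v_jobs p) s0) by rewrite (ready_jobs Rs0).
apply: run_for_ind => //=; first by rewrite /I big_ord0.
rewrite (ready_jobs Rs) /I => x s1 xm s1x same1 c1.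
have Rs1 : ready s1 by apply: ready_same same1 _ _ Rs0.
pose J y s' := vars s' v_flag = (\big[andb/true]_(x' < x) B x')
  && \big[andb/true]_(y' < y) ~~ [&& E x y', r x == j & r y' == j].
suff : J (vars s1 v_jobs) (run p s1) by rewrite (ready_jobs Rs1) /J big_ord_recr.
apply: run_for_ind => //=; first by rewrite /J big_ord0 andbT.
rewrite (ready_jobs Rs1) /J => y s2 ym s2y same2 c2.
have Rs2 : ready s2 by apply: ready_same same2 _ _ Rs1.
have s2x : vars s2 v_j = x by case: same2 => ->.
have s2j : vars s2 v_i = j by case: same2 => -> //; case: same1 => ->.
have s2r z : z < m -> arrays s2 a_rep z = r z.
  by case: same2 => _ -> //; case: same1 => _ -> // /sr.
rewrite big_ord_recr /= andbA !runE; set b := _ && _ in c2 *.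
have -> : eval s2 (Read a_conflict (cell v_j v_k)) = E0 (x * m + y).
  by rewrite -(ready_conflict Rs2) -s2x -s2y -eval_cell //; lia.
rewrite -/(E x y) !eval_neq /= s2x s2y s2j !s2r //.
case: (E x y) => /=; last by rewrite andbT.
case: (r x == j) => /=; last by rewrite andbT.
by case: (r y == j); rewrite /= ?andbT ?andbF.
Qed.

Lemma sum_correct s : ready s -> vars s v_a < n ->
  (forall x, x < m -> arrays s a_rep x = r x) ->
  vars (run p_sum s) v_acc = \sum_(x < m | r x == vars s v_i) U (vars s v_a) x.
Proof.
move=> Rs an sr; rewrite /p_sum runE run_assign; set s0 := set_var _ _ _.
have Rs0 : ready s0 by apply: ready_set_var.
pose I i s' := vars s' v_acc = \sum_(x < i | r x == vars s v_i) U (vars s v_a) x.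
set p := PIf _ _ _.
suff : I (vars s0 v_jobs) (run (PFor v_j v_jobs p) s0) by rewrite (ready_jobs Rs0).
apply: run_for_ind => //=; first by rewrite /I big_ord0.
rewrite (ready_jobs Rs) /I => x s1 xm s1x same1 c1.
have Rs1 : ready s1 by apply: ready_same same1 _ _ Rs0.
have [v1 a1] := same1.
rewrite big_mkcond big_ord_recr -big_mkcond /= /p !runE eval_neq /=.
rewrite s1x a1 // sr // v1 //=.
case: eqVneq => /= _; last by rewrite addn0.
rewrite c1; congr (_ + _).
have /= := eval_cell v_j Rs1 (_ : vars s1 v_a <= n + m); rewrite v1 //= s1x => ->.
  by rewrite (ready_utility Rs1).
by lia.
Qed.

Lemma fit_correct s : ready s ->
  (forall x, x < m -> arrays s a_rep x = r x) ->
  forall a j, a < n -> j < m -> arrays (run p_fit s) a_fit (a * m + j) = fits a j.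
Proof.
move=> Rs sr; rewrite /p_fit.
pose I i s' := forall a j, a < n -> j < i -> arrays s' a_fit (a * m + j) = fits a j.
set p := PSeq _ _.
suff : I (vars s v_jobs) (run (PFor v_i v_jobs p) s) by rewrite (ready_jobs Rs).
apply: run_for_ind => //=; rewrite (ready_jobs Rs) => j s1 jm s1j same1 fit1.
have Rs1 : ready s1 by apply: ready_same same1 _ _ Rs.
have s1r x : x < m -> arrays s1 a_rep x = r x by case: same1 => _ -> // /sr.
rewrite /p runE; set s2 := run p_independent s1.
have Rs2 : ready s2 by apply: ready_run.
have s2j : vars s2 v_i = j by rewrite run_var.
have s2f : vars s2 v_flag = fibre_free j.
  by rewrite independent_correct // s1j.
pose J a s' := (forall a' j', a' < n -> j' < j ->
    arrays s' a_fit (a' * m + j') = fits a' j') /\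
  forall a', a' < a -> arrays s' a_fit (a' * m + j) = fits a' j.
set q := PSeq _ _.
suff [fitj fita] : J (vars s2 v_agents) (run (PFor v_a v_agents q) s2).
  move=> a j' an /=; rewrite ltnS leq_eqVlt => /predU1P[->|j'j]; last exact: fitj.
  by apply: fita; rewrite (ready_agents Rs2).
apply: run_for_ind => //=.
  by split=> // a' j' ? ?; rewrite run_array // fit1.
rewrite (ready_agents Rs2) => a s3 an s3a same3 [fitj fita].
have Rs3 : ready s3 by apply: ready_same same3 _ _ Rs2.
have s3r x : x < m -> arrays s3 a_rep x = r x.
  by case: same3 => _ -> // /s1r; rewrite run_array.
have s3j : vars s3 v_i = j by case: same3 => ->.
have s3f : vars s3 v_flag = fibre_free j by case: same3 => ->.
rewrite /q runE; set s4 := run p_sum s3.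
have Rs4 : ready s4 by apply: ready_run.
have s4a : vars s4 v_a = a by rewrite run_var.
have s4j : vars s4 v_i = j by rewrite run_var.
rewrite run_write eval_cell ?s4a ?s4j //; last by lia.
have -> : eval s4 (Defs.Sub (Var v_flag) (Defs.Sub (Var v_target) (Var v_acc)))
    = fits a j.
  rewrite /= run_var // s3f (ready_target Rs4) sum_correct ?s3a ?s3j // /fits.
  by case: fibre_free => //=; set w := \sum_(_ < m | _) _; case: leqP; lia.
split=> [a' j' a'n j'j|a' a'a] /=.
  rewrite ifN; first by rewrite run_array // fitj.
  by apply/eqP => /(congr1 (modn^~ m)); rewrite !modnMDl !modn_small; lia.
move: a'a; rewrite ltnS leq_eqVlt; case: eqVneq => [->|na] /=; first by rewrite eqxx.
by move=> a'a; rewrite ifN ?run_array ?fita // eqn_add2r eqn_pmul2r //; lia.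
Qed.

End Fit.
End Spec.

Section AuctionSpec.

Variables (n m tgt : nat) (U0 E0 : nat -> nat).

Let ready := ready n m tgt U0 E0.

Lemma holdsP own a : reflect (holds m own a) (has (fun j => own j == a.+1) (iota 0 m)).
Proof.
apply: (iffP hasP) => [[j]|[j jm oj]]; last by exists j; rewrite ?mem_iota ?oj.
by rewrite mem_iota => /= jm /eqP oj; exists j.
Qed.

Lemma free_correct s : ready s ->
  let own := arrays s a_owner in
  let c := vars (run p_free s) v_free in
  c = 0 /\ (forall a, a < n -> holds m own a) \/
  exists a, [/\ a < n, c = a.+1 & lacks m own a].
Proof.
move=> Rs own; rewrite /p_free runE run_assign; set s0 := set_var _ _ _.
have Rs0 : ready s0 by apply: ready_set_var.
pose I i s' := vars s' v_free = 0 /\ (forall a, a < i -> holds m own a) \/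
  exists a, [/\ a < n, vars s' v_free = a.+1 & lacks m own a].
set p := PSeq _ _.
suff : I (vars s0 v_agents) (run (PFor v_a v_agents p) s0).
  by rewrite (ready_agents Rs0).
apply: run_for_ind => //=; first by left.
rewrite (ready_agents Rs) => a s1 an s1a same1 I1.
have Rs1 : ready s1 by apply: ready_same same1 _ _ Rs0.
rewrite /p !runE; set s2 := set_var s1 _ _.
have Rs2 : ready s2 by apply: ready_set_var.
set q := PFor _ _ _; set s3 := run q s2.
have s3f : vars s3 v_flag = has (fun j => own j == a.+1) (iota 0 m).
  pose J i s' := vars s' v_flag = has (fun j => own j == a.+1) (iota 0 i).
  suff : J (vars s2 v_jobs) s3 by rewrite (ready_jobs Rs2).
  apply: run_for_ind => //=; rewrite (ready_jobs Rs1) /J => k s4 km s4k same4 f4.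
  rewrite -[in iota 0 k.+1]addn1 iotaD has_cat /= orbF !runE eval_neq /= s4k.
  case: same4 => v4 a4; rewrite a4 // v4 //= s1a addn1.
  have -> : arrays s1 4 k = own k by case: same1 => _ ->.
  by case: eqVneq => _ /=; rewrite ?orbT ?orbF.
rewrite /= s3f.
have s3a : vars s3 v_a = a by rewrite run_var.
have s3v : vars s3 v_free = vars s1 v_free by rewrite run_var.
case: holdsP => [hold|nhold] /=.
  rewrite /I /= s3v; case: I1 => [[-> all_hold]|]; [left|by right].
  by split=> // b; rewrite ltnS leq_eqVlt => /predU1P[->|/all_hold].
right; exists a; split; rewrite //= ?s3a ?addn1 // => j jm.
by apply: contra_notN nhold => /eqP; exists j.
Qed.

Variables (fit : nat -> nat -> bool).

Let fitted (s : state) := forall a j, a < n -> j < m ->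
  arrays s a_fit (a * m + j) = fit a j.

Lemma best_correct s a : ready s -> fitted s -> a < n -> vars s v_free = a.+1 ->
  let b := vars (run p_best s) v_best in
  b = 0 /\ (forall j, j < m -> ~~ fit a j) \/
  exists j, [/\ j < m, b = j.+1, fit a j &
    forall k, k < m -> fit a k -> arrays s a_price j <= arrays s a_price k].
Proof.
move=> Rs Fs an sf; rewrite /p_best !runE /= sf subn1 /=; set s0 := set_var _ _ _.
have Rs0 : ready s0 by do 2!apply: ready_set_var => //.
pose I i s' := vars s' v_best = 0 /\ (forall j, j < i -> ~~ fit a j) \/
  exists j, [/\ j < m, vars s' v_best = j.+1, fit a j &
    forall k, k < i -> fit a k -> arrays s a_price j <= arrays s a_price k].
set p := PIf _ _ _.
suff : I (vars s0 v_jobs) (run (PFor v_k v_jobs p) s0) by rewrite (ready_jobs Rs0).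
apply: run_for_ind => //=; first by left.
rewrite (ready_jobs Rs) => k s1 km s1k same1 I1.
have Rs1 : ready s1 by apply: ready_same same1 _ _ Rs0.
have s1a : vars s1 v_a = a by case: same1 => ->.
have s1p i : arrays s1 a_price i = arrays s a_price i by case: same1 => _ ->.
rewrite /p !runE.
have -> : eval s1 (Read a_fit (cell v_a v_k)) = fit a k.
  rewrite -(Fs a k) // -s1a -s1k -(@eval_cell _ _ _ _ _ s1 v_a v_k Rs1); last by lia.
  by case: same1 => _ a1; rewrite -a1.
case: (boolP (fit a k)) => fak /=; last first.
  case: I1 => [[b0 nofit]|[j [jm bj faj best]]].
    left; split=> // j; rewrite ltnS leq_eqVlt => /predU1P[-> //|]; exact: nofit.
  right; exists j; split=> // i; rewrite ltnS leq_eqVlt => /predU1P[->|]; last first.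
    exact: best.
  by rewrite (negPf fak).
case: I1 => [[b0 nofit]|[j [jm bj faj best]]].
  rewrite b0 /=; right; exists k; split; rewrite //= ?s1k ?addn1 // => i.
  rewrite ltnS leq_eqVlt => /predU1P[-> //|ik] fai.
  by have := nofit _ ik; rewrite fai.
rewrite bj /= subn1 /= s1k !s1p.
case: (ltnP (arrays s a_price k) (arrays s a_price j)) => le_kj.
  rewrite -lt0n subn_gt0 le_kj; right; exists k; split; rewrite //= ?s1k ?addn1 // => i.
  rewrite ltnS leq_eqVlt => /predU1P[-> //|ik] fai.
  exact: leq_trans (ltnW le_kj) (best _ ik fai).
rewrite -lt0n subn_gt0 ltnNge le_kj; right; exists j; split=> // i.
by rewrite ltnS leq_eqVlt => /predU1P[-> //|]; apply: best.
Qed.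

Lemma bid_correct s : ready s -> fitted s ->
  bid n m fit (arrays s a_owner) (arrays s a_price)
    (arrays (run p_bid s) a_owner) (arrays (run p_bid s) a_price).
Proof.
move=> Rs Fs; rewrite /p_bid runE; set s1 := run p_free s.
have Rs1 : ready s1 by apply: ready_run Rs.
have Fs1 : fitted s1 by move=> a j an jm; rewrite run_array // Fs.
have s1o i : arrays s1 a_owner i = arrays s a_owner i by rewrite run_array.
have s1p i : arrays s1 a_price i = arrays s a_price i by rewrite run_array.
rewrite run_if /=.
case: (free_correct Rs) => [[-> all_hold]|[a [an s1f free_a]]] /=; first exact: BidNone.
rewrite s1f /= run_seq; set s2 := run p_best s1.
rewrite run_if run_seq !run_write run_skip.
have s2o i : arrays s2 a_owner i = arrays s a_owner i by rewrite run_array.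
have s2p i : arrays s2 a_price i = arrays s a_price i by rewrite run_array.
have s2f : vars s2 v_free = a.+1 by rewrite run_var.
have := best_correct Rs1 Fs1 an s1f; rewrite -/s2 /=.
case=> [[-> nofit]|[j [jm s2b faj best]]] /=.
  exact: BidStuck nofit.
rewrite s2b /= !subn1 /= s2f.
apply: (@BidOn _ _ _ _ _ _ _ a j) => //= k.
- by move=> km fak; rewrite -!s1p; apply: best.
- by rewrite s2o.
- by rewrite !s2p addn1.
Qed.

Lemma auction_correct s : ready s -> fitted s ->
  let own := arrays (run p_auction s) a_owner in
  fair n m fit own /\
  ((exists M, [/\ forall a, a < n -> M a < m, forall a, a < n -> fit a (M a) &
      forall a b, a < n -> b < n -> M a = M b -> a = b]) ->
    forall a, a < n -> holds m own a).
Proof.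
move=> Rs Fs; rewrite /p_auction runE; set s1 := run _ s.
have Rs1 : ready s1 by apply: ready_run Rs.
have Fs1 : fitted s1 by move=> a j an jm; rewrite run_array // Fs.
have [own0 price0] : (forall j, j < m -> arrays s1 a_owner j = 0) /\
    (forall j, j < m -> arrays s1 a_price j = 0).
  pose I i s' := (forall j, j < i -> arrays s' a_owner j = 0) /\
    (forall j, j < i -> arrays s' a_price j = 0).
  suff : I (vars s v_jobs) s1 by rewrite (ready_jobs Rs).
  apply: run_for_ind => //= k s2 _ s2k _ [o0 p0]; rewrite !runE /= s2k.
  split=> j /=; rewrite ltnS leq_eqVlt; case: eqVneq => //= _; first exact: o0.
  exact: p0.
have loop (I : nat -> (nat -> nat) -> (nat -> nat) -> Prop) :
    (forall k own price own' price', bid n m fit own price own' price' ->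
      I k own price -> I k.+1 own' price') ->
    I 0 (arrays s1 a_owner) (arrays s1 a_price) ->
    let s2 := run (PFor v_i v_size (PFor v_j v_size p_bid)) s1 in
    I ((n + m).+1 * (n + m).+1) (arrays s2 a_owner) (arrays s2 a_price).
  move=> IS I0.
  pose J i s' := I (i * (n + m).+1) (arrays s' a_owner) (arrays s' a_price).
  suff : J (vars s1 v_size) (run (PFor v_i v_size (PFor v_j v_size p_bid)) s1).
    by rewrite (ready_size Rs1).
  apply: run_for_ind => //= i s2 _ _ same2 J2.
  have Rs2 : ready s2 by apply: ready_same same2 _ _ Rs1.
  have Fs2 : fitted s2 by move=> a j an jm; case: same2 => _ ->; rewrite ?Fs1.
  pose K j s' := I (i * (n + m).+1 + j) (arrays s' a_owner) (arrays s' a_price).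
  suff : K (vars s2 v_size) (run (PFor v_j v_size p_bid) s2).
    by rewrite (ready_size Rs2) /J mulSnr.
  apply: run_for_ind => //=; first by rewrite /K addn0.
  move=> j s3 _ _ same3 K3; rewrite /K addnS /=; apply: IS K3.
  apply: bid_correct; first by apply: ready_same same3 _ _ Rs2.
  by move=> a k an km; case: same3 => _ ->; rewrite ?Fs2.
split.
  apply: (loop (fun _ own _ => fair n m fit own)) => [k o p o' p'|j /own0 ->] //.
  exact: bid_fair.
case=> M [M_lt M_fit M_inj].
have bal := loop (balanced n m fit) (bid_balanced M_lt M_fit M_inj)
  (balanced0 n fit own0 price0).
by apply: (balanced_end bal); nia.
Qed.

End AuctionSpec.

(** * Instances *)

Definition table (P : cffa) (r : nat) : nat -> nat := arrays (input P) r.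

Arguments table : simpl never.

Lemma nth_allpairs (S T V : Type) (f : S -> T -> V) v0 x0 y0 s t i j :
  i < size s -> j < size t ->
  nth v0 [seq f x y | x <- s, y <- t] (i * size t + j) = f (nth x0 s i) (nth y0 t j).
Proof.
move=> + jt; elim: s i => // x s IHs [|i] si; rewrite allpairs_cons nth_cat size_map.
  by rewrite mul0n jt (nth_map y0).
rewrite ifN ?mulSn -?addnA ?addKn ?IHs //.
by rewrite -leqNgt leq_addr.
Qed.

Section Instance.

Variable P : cffa.

Notation n := (agents P).
Notation m := (jobs P).
Notation U0 := (table P a_utility).
Notation E0 := (table P a_conflict).

Lemma input_utility (a : 'I_n) (x : 'I_m) : U0 (a * m + x) = utility a x.
Proof.
have := @nth_allpairs _ _ _ (@utility P) 0 a x (enum 'I_n) (enum 'I_m) a x.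
by rewrite !size_enum_ord !nth_ord_enum; apply.
Qed.

Lemma input_conflict (x y : 'I_m) : E0 (x * m + y) = conflict x y.
Proof.
have := @nth_allpairs _ _ _ (fun x y : 'I_m => nat_of_bool (conflict x y)) 0 x y
  (enum 'I_m) (enum 'I_m) x y.
by rewrite !size_enum_ord !nth_ord_enum; apply.
Qed.

Notation fit := (fits m (target P) U0 E0).

Lemma fitsE (r : nat -> nat) (a : 'I_n) j :
  fit r a j = [forall x : 'I_m, forall y : 'I_m,
      ~~ [&& conflict x y, r x == j & r y == j]]
    && (target P <= \sum_(x < m | r x == j) utility a x).
Proof.
rewrite /fits /fibre_free big_andE; congr (_ && (_ <= _)).
  apply: eq_forallb => x; rewrite /= big_andE; apply: eq_forallb => y /=.
  by rewrite input_conflict eqb0 negbK.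
by apply: eq_bigr => x _; rewrite input_utility.
Qed.

Lemma solvable_of_fair r own : fair n m (fit r) own ->
  (forall a, a < n -> holds m own a) -> solvable P.
Proof.
move=> own_fair all_hold.
have /fin_all_exists[j jP] (a : 'I_n) : exists j : 'I_m, own j = a.+1.
  by have [j jm oj] := all_hold a (ltn_ord a); exists (Ordinal jm).
have fit_j (a : 'I_n) : fit r a (j a).
  by have [] := own_fair (j a) (ltn_ord _); rewrite jP.
exists (fun a => [set x : 'I_m | r x == j a]); split=> [a x y|a|a b ab].
- have := fit_j a; rewrite fitsE => /andP[/forallP/(_ x)/forallP/(_ y) + _].
  by rewrite !inE => + rx ry; rewrite rx ry !andbT.
- have := fit_j a; rewrite fitsE => /andP[_].
  by under [X in _ -> _ <= X]eq_bigl => x do rewrite inE.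
- apply/pred0P => x /=; rewrite !inE; apply: contraNF ab => /andP[/eqP ra /eqP rb].
  by apply/eqP/val_inj/eqP; rewrite /= -eqSS -!jP -ra -rb.
Qed.

Lemma fair_of_solution phi : @is_solution P phi ->
  exists r M, [/\ forall v, v < m -> r v <= v,
    forall v, v < m -> E0 (v * m + r v) = 0,
    forall a, a < n -> M a < m,
    forall a, a < n -> fit r a (M a) &
    forall a b, a < n -> b < n -> M a = M b -> a = b].
Proof.
move=> [indep rich disj].
have /fin_all_exists2[mu mu_in mu_min] (a : 'I_n) :
    exists2 x : 'I_m, x \in phi a & forall y, y \in phi a -> x <= y.
  case: (set_0Vmem (phi a)) => [phi0|[x0 x0a]].
    by have := rich a; rewrite phi0 big_set0 leqNgt target_gt0.
  by case: (@arg_minnP _ x0 (mem (phi a)) val x0a) => x; exists x.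
have phi_inj a b x : x \in phi a -> x \in phi b -> a = b.
  move=> xa xb; apply: contraTeq xb => /disj/disjointFr.
  by move=> /(_ x xa) ->.
have mu_inj : injective mu by move=> a b e; apply: (phi_inj a b (mu a)); [|rewrite e].
pose rep (x : 'I_m) : 'I_m := if [pick a | x \in phi a] is Some a then mu a else x.
have rep_le x : rep x <= x by rewrite /rep; case: pickP => // a /mu_min.
have rep_free x : ~~ conflict x (rep x).
  rewrite /rep; case: pickP => [a xa|_]; first exact: (indep a x (mu a) xa (mu_in a)).
  by rewrite conflict_irr.
have repE x a : (rep x == mu a) = (x \in phi a).
  rewrite /rep; case: pickP => [b xb|nox].
    rewrite (inj_eq mu_inj); apply/eqP/idP => [<- //|]; exact: phi_inj.
  by rewrite nox; apply: contraFF (nox a) => /eqP ->; apply: mu_in.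
pose r v := if insub v is Some x then val (rep x) else v.
have rE (x : 'I_m) : r x = rep x by rewrite /r valK.
pose M a := if insub a is Some b then val (mu b) else 0.
have ME (a : 'I_n) : M a = mu a by rewrite /M valK.
exists r, M; split=> [v vm|v vm|a an|a an|a b an bn].
- by rewrite (rE (Ordinal vm)) rep_le.
- rewrite (rE (Ordinal vm)) -[v]/(val (Ordinal vm)) input_conflict.
  by rewrite (negPf (rep_free _)).
- by rewrite (ME (Ordinal an)).
- rewrite (ME (Ordinal an)) -[a]/(val (Ordinal an)) fitsE; apply/andP; split.
    apply/forallP => x; apply/forallP => y; rewrite !rE !val_eqE !repE.
    by apply/negP => /and3P[exy xa ya]; have := indep _ x y xa ya; rewrite exy.
  by under eq_bigl => x do rewrite rE val_eqE repE; apply: rich.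
- rewrite (ME (Ordinal an)) (ME (Ordinal bn)) => /val_inj/mu_inj.
  by move/(congr1 val).
Qed.

Lemma card_edges : #|edges (@conflict P)|
  = \sum_(x < m) \sum_(y < m) (y < x) && conflict x y.
Proof.
pose D := [set p : 'I_m * 'I_m | (p.2 < p.1) && conflict p.1 p.2].
have -> : edges (@conflict P) = [set [set p.1; p.2] | p in D].
  apply/setP => A; apply/imset2P/imsetP => [[x y _] | [[x y]]].
    rewrite inE /= => exy ->; case: (ltngtP y x) => [yx|xy|/val_inj yx].
    - by exists (x, y); rewrite // inE yx.
    - by exists (y, x); [rewrite inE /= xy conflict_sym | rewrite setUC].
    - by move: exy; rewrite yx conflict_irr.
  by rewrite inE => /andP[_ exy] ->; exists x y; rewrite // inE.
rewrite card_in_imset => [|[x y] [x' y']].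
  rewrite pair_big -sum1_card big_mkcond /=; apply: eq_bigr => -[x y] _.
  by rewrite inE /=; case: ifP.
rewrite !inE /= => /andP[yx _] /andP[yx' _] /setP e.
have := e x; have := e y; have := e x'; have := e y'; rewrite !inE !eqxx !orbT /=.
rewrite -!val_eqE /= => e1 e2 e3 e4; apply/eqP; rewrite xpair_eqE -!val_eqE /=.
lia.
Qed.

Lemma npairsE : npairs m E0 = nonedges P.
Proof.
suff : npairs m E0 + #|edges (@conflict P)| = 'C(m, 2).
  by rewrite /nonedges => <-; rewrite addnK.
rewrite card_edges -bin2_sum big_mkord /npairs -big_split; apply: eq_bigr => x _ /=.
rewrite -sum1_count -{1}(subn0 m) -/(index_iota 0 m) big_mkcond big_mkord -big_split /=.
rewrite [in RHS](_ : val x = \sum_(y < m) (y < x)).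
  apply: eq_bigr => y _; rewrite /pair input_conflict.
  by case: (y < x); case: conflict.
rewrite -[LHS]card_ord -sum1_card (big_ord_widen _ (fun=> 1) (ltnW (ltn_ord x))).
by rewrite big_mkcond; apply: eq_bigr => y _; case: ltnP.
Qed.

End Instance.

Section Search.

Variable P : cffa.

Notation n := (agents P).
Notation m := (jobs P).
Notation ready := (ready n m (target P) (table P a_utility) (table P a_conflict)).
Notation fit := (fits m (target P) (table P a_utility) (table P a_conflict)).

Lemma try_correct s : ready s -> vars s v_count = 2 ^ nonedges P ->
  let s' := run p_try s in
  [/\ vars s v_answer != 0 -> vars s' v_answer != 0,
      vars s' v_answer != 0 -> vars s v_answer != 0 \/ solvable P &
      forall r M, (forall v, v < m -> r v <= v) ->
        (forall v, v < m -> table P a_conflict (v * m + r v) = 0) ->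
        (forall a, a < n -> M a < m) -> (forall a, a < n -> fit r a (M a)) ->
        (forall a b, a < n -> b < n -> M a = M b -> a = b) ->
        vars s v_code = encode (bits_below m (table P a_conflict) r 0) ->
        vars s' v_answer != 0].
Proof.
move=> Rs Ns; rewrite /p_try !(run_seq, run_if, run_assign, run_skip).
set s1 := run p_decode s; set s2 := run p_fit s1; set s3 := run p_auction s2.
have Rs1 : ready s1 by apply: ready_run Rs.
have Rs2 : ready s2 by apply: ready_run Rs1.
have Rs3 : ready s3 by apply: ready_run Rs2.
have s4a : vars (run p_free s3) v_answer = vars s v_answer by rewrite !run_var.
have fit2 r : (forall v, v < m -> arrays s1 a_rep v = r v) ->
    forall a j, a < n -> j < m -> arrays s2 a_fit (a * m + j) = fit r a j.
  by move=> rE; apply: (fit_correct Rs1).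
have [fair3 _] := auction_correct Rs2 (fit2 _ (fun _ _ => erefl)).
split=> /=.
- by case: ifP; rewrite /= ?s4a.
- case: (free_correct Rs3) => [[free0 all_hold] _|[a [_ -> _]]].
    by right; apply: solvable_of_fair fair3 all_hold.
  by rewrite s4a; left.
- move=> r M r_le r_free M_lt M_fit M_inj codeE.
  have rE : forall v, v < m -> arrays s1 a_rep v = r v.
    apply: (decode_correct r_le _ Rs) => // [v vm|]; first by rewrite r_free.
    by rewrite npairsE.
  have [_ hold3] := auction_correct Rs2 (fit2 r rE).
  case: (free_correct Rs3) => [[-> _] //|[a [an _ free_a]]].
  have [|j jm oj] := hold3 _ a an; first by exists M.
  by have := free_a j jm; rewrite oj eqxx.
Qed.

Lemma search_correct s : ready s -> vars s v_count = 2 ^ nonedges P ->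
  vars s v_answer = 0 -> vars (run p_search s) v_answer != 0 <-> solvable P.
Proof.
move=> Rs Ns s0; split.
  pose I (i : nat) s' := vars s' v_answer != 0 -> solvable P.
  suff : I (vars s v_count) (run p_search s) by [].
  apply: run_for_ind => //=; first by rewrite /I /= s0.
  move=> i s1 _ _ same1 I1.
  have Rs1 : ready s1 by apply: ready_same same1 _ _ Rs.
  have [|_ sound _] := try_correct Rs1; first by case: same1 => ->.
  by rewrite /I /= => /sound[/I1|].
case=> phi /fair_of_solution[r [M [r_le r_free M_lt M_fit M_inj]]].
set code := encode (bits_below m (table P a_conflict) r 0).
have code_lt : code < 2 ^ nonedges P.
  by rewrite -npairsE -(size_bits m (table P a_conflict) r) encode_lt.
pose I i s' := code < i -> vars s' v_answer != 0.
suff : I (vars s v_count) (run p_search s) by apply; rewrite Ns.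
apply: run_for_ind => //= i s1 _ s1i same1 I1.
have Rs1 : ready s1 by apply: ready_same same1 _ _ Rs.
have [|mono _ complete] := try_correct Rs1; first by case: same1 => ->.
rewrite /I ltnS leq_eqVlt /= => /predU1P[ci|/I1/mono //].
by apply: (complete r M) => //; rewrite s1i -ci.
Qed.

Lemma nonedges_bound : 2 ^ nonedges P <= maxn 1 ((2 * nonedges P) ^ (nonedges P + 1)).
Proof.
case: (nonedges P) => [|t]; first by rewrite leq_maxl.
rewrite leq_max; apply/orP; right; rewrite addn1.
apply: (@leq_trans (2 ^ t.+2)); first by rewrite leq_exp2l.
by rewrite leq_exp2r // leq_pmulr.
Qed.

Lemma main_correct : exists k s,
  [/\ exec main (input P) k s,
      k <= cost (fun=> (n + m).+1) p_size + cost (fun=> (n + m).+1) p_init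
        + (2 ^ nonedges P * (cost (fun=> (n + m).+1) p_try + 8) + 6) + 2
    & vars s 0 != 0 <-> solvable P].
Proof.
set S := (n + m).+1.
pose beta b := if b == v_count then 2 ^ nonedges P else S.
pose s1 := run p_size (input P); pose s2 := run p_init s1; pose s3 := run p_search s2.
have s1S : vars s1 v_size = S by rewrite /= addn1.
have R1 : ready (run p_rows s1) by apply: rows_correct.
have R2 : ready s2 by rewrite /s2 run_seq; apply: ready_run R1.
have N2 : vars s2 v_count = 2 ^ nonedges P.
  by rewrite -npairsE /s2 run_seq (count_correct R1).
have [||k1 ex1 le1] := @exec_compile (fun=> S) p_size (input P) => //.
have [||k2 ex2 le2] := @exec_compile (fun=> S) p_init s1 => //.
  move=> b; rewrite !inE => /or3P[] /eqP ->; split=> //=; rewrite /S; lia.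
have [||k3 ex3 le3] := @exec_compile beta p_search s2 => //.
  have bP : all (fun b => b \in [:: v_agents; v_jobs; v_size; v_count])
    (bounds p_search) by [].
  have bM : all (fun b => b \notin mvars p_search) (bounds p_search) by [].
  move=> b hb; split; last exact: (allP bM).
  have := allP bP b hb; rewrite !inE => /or4P[] /eqP ->; rewrite /beta /= ?N2 //.
  - by rewrite (ready_agents R2) /S; lia.
  - by rewrite (ready_jobs R2) /S; lia.
  - by rewrite (ready_size R2).
exists (k1 + (k2 + (k3 + 2))), (set_var s3 0 (vars s3 v_answer)); split.
- apply: ExecSeq ex1 _; apply: ExecSeq ex2 _; apply: ExecSeq ex3 _; exact: ExecAssign.
- have e3 : cost beta p_search = 2 ^ nonedges P * (cost (fun=> S) p_try + 8) + 6 by [].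
  by rewrite e3 in le3; lia.
- by rewrite /= search_correct // run_var.
Qed.

End Search.

Lemma total_cost_le c0 c1 c2 z1 z2 d1 d2 N N' S X :
  c1 <= z1 * S ^ d1 -> c2 <= z2 * S ^ d2 -> 0 < N <= N' -> 0 < S <= 2 * X ->
  c0 + c1 + (N * (c2 + 8) + 6) + 2
    <= (c0 + z1 + z2 + 16) * 2 ^ (d1 + d2) * (N' * X ^ (d1 + d2)).
Proof.
move=> le1 le2 /andP[N0 leN] /andP[S0 leS].
set A := S ^ (d1 + d2); set B := N' * (2 * X) ^ (d1 + d2).
have A0 : 0 < A by rewrite expn_gt0 S0.
have leA : A <= (2 * X) ^ (d1 + d2).
  by rewrite /A; case: (d1 + d2) => [|e]; rewrite ?expn0 // leq_exp2r.
have AB : A <= B by apply: leq_trans leA _; rewrite leq_pmull //; lia.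
have B0 : 0 < B by exact: leq_trans AB.
have h0 : c0 <= c0 * B by rewrite leq_pmulr.
have h1 : c1 <= z1 * B.
  apply: leq_trans le1 _; rewrite leq_mul2l (leq_trans _ AB) ?orbT //.
  by rewrite leq_pexp2l ?leq_addr.
have h2 : N * c2 <= z2 * B.
  apply: leq_trans (leq_mul leN le2) _.
  rewrite mulnCA !leq_mul2l (leq_trans _ leA) ?orbT //.
  by rewrite leq_pexp2l ?leq_addl.
have h3 : N <= B by apply: leq_trans leN _; rewrite leq_pmulr // (leq_trans A0).
have -> : (c0 + z1 + z2 + 16) * 2 ^ (d1 + d2) * (N' * X ^ (d1 + d2))
    = (c0 + z1 + z2 + 16) * B.
  by rewrite /B expnMn -mulnA [2 ^ _ * (N' * _)]mulnCA.
by rewrite !mulnDl mulnDr; lia.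
Qed.

Theorem theorem7 :
  exists (p : cmd) (C c : nat), solves_cffa_in p (time_bound C c).
Proof.
exists main, ((cost id p_size + psize p_init + psize p_try + 16)
  * 2 ^ (depth p_init + depth p_try)), (depth p_init + depth p_try) => P.
have [k [s [ex le_k ans]]] := main_correct P.
exists k, s; split=> //; apply: leq_trans le_k _.
have cost_le p : cost (fun=> (agents P + jobs P).+1) p
    <= psize p * (agents P + jobs P).+1 ^ depth p by exact: cost_poly.
apply: (total_cost_le (cost id p_size) (cost_le p_init) (cost_le p_try)).
  by rewrite expn_gt0 nonedges_bound.
by lia.
Qed.
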